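(* Let $f:\mathbb{R}^D\to\mathbb{R}$ be continuous with effective dimension $d_e$, $d_e<D$ and $d_e\le d$, with effective subspace $\mathcal{T}$ and constant subspace $\mathcal{T}^\perp$ spanned by the columns of the orthonormal matrices $U\in\mathbb{R}^{D\times d_e}$ and $V\in\mathbb{R}^{D\times(D-d_e)}$, respectively. Assume that there is a global minimizer $\boldsymbol{x}^*$ of $f$ over $\mathcal{X}=[-1,1]^D$ whose associated set $G^*$ is non-degenerate, and that $f$ is Lipschitz continuous on $\mathbb{R}^D$ (in the Euclidean norm). Let $\epsilon>0$, $\lambda\in(0,\epsilon)$, and consider the X-REGO process (defined in the context). Assume there exists $\rho\in(0,1]$ such that $\mathbb{P}[S^k=1\mid\mathcal{F}^{k-1/2}]=\mathbb{E}[S^k\mid\mathcal{F}^{k-1/2}]\ge\rho$ for all $k\ge1$. Then $$\lim_{k\to\infty}\mathbb{P}[\boldsymbol{x}^k_{opt}\in G_\epsilon]=\lim_{k\to\infty}\mathbb{P}[f(\boldsymbol{x}^k_{opt})\le f^*+\epsilon]=1.$$ Furthermore, for any $\xi\in(0,1)$, $$\mathbb{P}[\boldsymbol{x}^k_{opt}\in G_\epsilon]=\mathbb{P}[f(\boldsymbol{x}^k_{opt})\le f^*+\epsilon]\ge\xi\quad\text{for all }k\ge K_\xi,\qquad K_\xi:=\left\lceil\frac{|\log(1-\xi)|}{\tau\rho}\right\rceil,$$ where $\tau\in(0,1]$ is a constant such that, for every $\boldsymbol{p}\in\mathcal{X}$ and a $D\times d$ Gaussian matrix $A$, the reduced problem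 with $A$ and $\boldsymbol{p}$ is $(\epsilon-\lambda)$-successful with probability at least $\tau$ (such a constant exists under the stated hypotheses on $f$).
   Context: A function $f:\mathbb{R}^D\to\mathbb{R}$ has effective dimension $d_e$ if there is a linear subspace $\mathcal{T}$ of dimension $d_e$ such that $f(\boldsymbol{x}_\top+\boldsymbol{x}_\perp)=f(\boldsymbol{x}_\top)$ for all $\boldsymbol{x}_\top\in\mathcal{T}$ and $\boldsymbol{x}_\perp\in\mathcal{T}^\perp$, and $d_e$ is the smallest integer with this property. $\mathcal{T}$ and $\mathcal{T}^\perp$ are called the effective and constant subspaces of $f$. For $\boldsymbol{x}\in\mathbb{R}^D$, $\boldsymbol{x}_\top=UU^T\boldsymbol{x}$. A Gaussian matrix is a random matrix with independent $\mathcal{N}(0,1)$ entries. For a global minimizer $\boldsymbol{x}^*$ of $f$ over $\mathcal{X}$, let $G^*:=\{\boldsymbol{x}\in\mathcal{X}:\boldsymbol{x}\in\boldsymbol{x}^*_\top+\mathcal{T}^\perp\}$ and $\bar G^*:=\{\boldsymbol{g}\in\mathbb{R}^{D-d_e}:\boldsymbol{x}^*_\top+V\boldsymbol{g}\in G^*\}$. $G^*$ is non-degenerate if $\mathrm{Vol}(\bar G^* )>0$ (Lebesgue volume in $\mathbb{R}^{D-d_e}$). Let $f^*=\min_{\boldsymbol{x}\in\mathcal{X}}f(\boldsymbol{x})$ and $G_\epsilon:=\{\boldsymbol{x}\in\mathcal{X}:f(\boldsymbol{x})\le f^*+\epsilon\}$. The reduced problem with matrix $A\in\mathbb{R}^{D\times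 d}$ and point $\boldsymbol{p}\in\mathcal{X}$ is: minimize $f(A\boldsymbol{y}+\boldsymbol{p})$ over $\boldsymbol{y}\in\mathbb{R}^d$ subject to $A\boldsymbol{y}+\boldsymbol{p}\in\mathcal{X}$. For $\eta>0$ it is $\eta$-successful if there is $\boldsymbol{y}^*\in\mathbb{R}^d$ with $f(A\boldsymbol{y}^*+\boldsymbol{p})\le f^*+\eta$ and $A\boldsymbol{y}^*+\boldsymbol{p}\in\mathcal{X}$. X-REGO process: start from an $\mathcal{X}$-valued random variable $\boldsymbol{p}^0$. For each $k\ge1$: draw a $D\times d$ Gaussian matrix $A^k$, independent of $\mathcal{F}^{k-1}$ (defined below); compute (approximately, and possibly by a stochastic algorithm) a random point $\boldsymbol{y}^k\in\mathbb{R}^d$ that is feasible for the reduced problem $(\mathrm{RP}\mathcal{X}^k)$ with matrix $A^k$ and point $\boldsymbol{p}^{k-1}$, i.e. $A^k\boldsymbol{y}^k+\boldsymbol{p}^{k-1}\in\mathcal{X}$; let $f^k_{min}$ be the optimal value of $(\mathrm{RP}\mathcal{X}^k)$ and $\boldsymbol{x}^k:=A^k\boldsymbol{y}^k+\boldsymbol{p}^{k-1}$; choose (deterministically or randomly) an $\mathcal{X}$-valued $\boldsymbol{p}^k$. Let $\boldsymbol{x}^k_{opt}$ be the point among $\boldsymbol{x}^1,\dots,\boldsymbol{x}^k$ with the smallest value of $f$. $\mathcal{F}^k=\sigma(A^1,\dots,A^k,\boldsymbol{y}^1,\dots,\boldsymbol{y}^k,\boldsymbol{p}^0,\dots,\boldsymbol{p}^k)$,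 $\mathcal{F}^0=\sigma(\boldsymbol{p}^0)$, and $\mathcal{F}^{k-1/2}=\sigma(A^1,\dots,A^k,\boldsymbol{y}^1,\dots,\boldsymbol{y}^{k-1},\boldsymbol{p}^0,\dots,\boldsymbol{p}^{k-1})$. $S^k$ is the indicator of the event that $(\mathrm{RP}\mathcal{X}^k)$ is solved to accuracy $\lambda$: $f(A^k\boldsymbol{y}^k+\boldsymbol{p}^{k-1})\le f^k_{min}+\lambda$. *)

(* Defs.v *)
From HB Require Import structures.
From mathcomp Require Import all_boot all_order all_algebra.
From mathcomp Require Import all_classical all_reals all_analysis.

Set Implicit Arguments.
Unset Strict Implicit.
Unset Printing Implicit Defensive.

Import Order.TTheory GRing.Theory Num.Theory.
Import numFieldTopology.Exports numFieldNormedType.Exports.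

Local Open Scope classical_set_scope.
Local Open Scope ring_scope.

(* Points of R^n are column vectors 'cV[R]_n.  The norm that the library puts
   on matrices is the sup norm, hence the Euclidean one below; both induce the
   same topology. *)
Section Euclidean.
Context {R : realType}.

Definition dotv n (x y : 'cV[R]_n) : R := \sum_(i < n) x i 0 * y i 0.

Definition enorm n (x : 'cV[R]_n) : R := Num.sqrt (dotv x x).

Definition lipschitz_euclid n (f : 'cV[R]_n -> R) : Prop :=
  exists L : R, forall x y, `|f x - f y| <= L * enorm (x - y).

Definition orthocomp n (T : {vspace 'cV[R]_n}) : set 'cV[R]_n :=
  [set x | forall t, t \in T -> dotv t x = 0].

Definition constant_along n (f : 'cV[R]_n -> R) (T : {vspace 'cV[R]_n}) : Prop :=
  forall xt xp, xt \in T -> orthocomp T xp -> f (xt + xp) = f xt.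

(* T witnesses that f has effective dimension de. *)
Definition effective_subspace n (f : 'cV[R]_n -> R) (de : nat)
    (T : {vspace 'cV[R]_n}) : Prop :=
  [/\ \dim T = de, constant_along f T &
      forall T' : {vspace 'cV[R]_n}, constant_along f T' -> (de <= \dim T')%N].

(* The columns of M are an orthonormal basis of the subspace S. *)
Definition orthonormal_basis m n (M : 'M[R]_(m, n)) (S : set 'cV[R]_m) : Prop :=
  M^T *m M = 1%:M /\ range (fun z : 'cV[R]_n => M *m z) = S.

Definition closed_box n (a b : 'cV[R]_n) : set 'cV[R]_n :=
  [set x | forall i, a i 0 <= x i 0 <= b i 0].

(* Lebesgue (outer) measure on R^n, as the infimum of the total volumes of the
   countable coverings by boxes; on Lebesgue measurable sets, e.g. closed ones,
   it is the Lebesgue measure. *)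
Definition lebesgue_vol n (S : set 'cV[R]_n) : \bar R :=
  ereal_inf [set v | exists a b : nat -> 'cV[R]_n,
    [/\ forall k i, a k i 0 <= b k i 0,
        S `<=` \bigcup_k closed_box (a k) (b k) &
        v = (\sum_(0 <= k <oo) (\prod_(i < n) (b k i 0 - a k i 0))%:E)%E]].

End Euclidean.

Section Problem.
Context {R : realType} {D : nat}.

Definition cube : set 'cV[R]_D := [set x | forall i, -1 <= x i 0 <= 1].

Variable f : 'cV[R]_D -> R.

Definition global_minimizer (xs : 'cV[R]_D) : Prop :=
  cube xs /\ forall x, cube x -> f xs <= f x.

Definition fmin : R := inf (f @` cube).

Definition Geps (eps : R) : set 'cV[R]_D :=
  [set x | cube x /\ f x <= fmin + eps].

Definition Gstar de (U : 'M[R]_(D, de)) (T : {vspace 'cV[R]_D})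
    (xs : 'cV[R]_D) : set 'cV[R]_D :=
  [set x | cube x /\ exists2 w, orthocomp T w & x = U *m U^T *m xs + w].

Definition Gstar_bar de (U : 'M[R]_(D, de)) (V : 'M[R]_(D, D - de))
    (T : {vspace 'cV[R]_D}) (xs : 'cV[R]_D) : set 'cV[R]_(D - de) :=
  [set g | Gstar U T xs (U *m U^T *m xs + V *m g)].

Section Reduced.
Context {d : nat}.
Implicit Types (A : 'M[R]_(D, d)) (p : 'cV[R]_D) (y : 'cV[R]_d).

Definition rp_feasible A p : set 'cV[R]_d := [set y | cube (A *m y + p)].

Definition rp_min A p : R := inf [set f (A *m y + p) | y in rp_feasible A p].

Definition rp_successful A p (eta : R) : Prop :=
  exists2 y, rp_feasible A p y & f (A *m y + p) <= fmin + eta.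

End Reduced.
End Problem.

Section Probability.
Context {R : realType} {disp : measure_display} {T : measurableType disp}.
Variable P : probability T R.

(* Random matrices are handled through their entries: the Borel sigma-algebra
   of R^(m x n) is generated by the coordinate maps. *)
Definition measurable_mx m n (M : T -> 'M[R]_(m, n)) : Prop :=
  forall i j, measurable_fun setT (fun w => M w i j).

Definition entry_events m n (M : T -> 'M[R]_(m, n)) : set (set T) :=
  \bigcup_i \bigcup_j preimage_set_system setT (fun w => M w i j) measurable.

Definition gaussian_mx m n (M : T -> 'M[R]_(m, n)) : Prop :=
  [/\ measurable_mx M,
      forall i j (B : set R), measurable B ->
        P [set w | B (M w i j)] = normal_prob 0 1 B &
      (* some of the B i j may be setT, so this is the product rule for every
         subfamily of the entries *)
      forall B : 'I_m -> 'I_n -> set R, (forall i j, measurable (B i j)) ->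
        P [set w | forall i j, B i j (M w i j)] =
        (\prod_(i < m) \prod_(j < n) P [set w | B i j (M w i j)])%E].

Definition independent (F G : set (set T)) : Prop :=
  forall E E', F E -> G E' -> P (E `&` E') = (P E * P E')%E.

(* Y is a version of the conditional expectation of X given the
   sub-sigma-algebra G. *)
Definition is_cond_exp (G : set (set T)) (X Y : T -> R) : Prop :=
  [/\ forall B : set R, measurable B -> G (Y @^-1` B),
      P.-integrable setT (EFin \o Y) &
      forall E, G E ->
        (\int[P]_(w in E) (Y w)%:E = \int[P]_(w in E) (X w)%:E)%E].

End Probability.

Section XREGO.
Context {R : realType} {disp : measure_display} {T : measurableType disp}.
Context {D d : nat}.
Variables (P : probability T R) (f : 'cV[R]_D -> R).
(* A 0 and y 0 are not used. *)
Variables (A : nat -> T -> 'M[R]_(D, d)) (y : nat -> T -> 'cV[R]_d)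
          (p : nat -> T -> 'cV[R]_D).

(* sigma(A^1, ..., A^a, y^1, ..., y^b, p^0, ..., p^c) *)
Definition history (a b c : nat) : set (set T) :=
  <<s [set E | [\/ exists2 l, (0 < l <= a)%N & entry_events (A l) E,
                   exists2 l, (0 < l <= b)%N & entry_events (y l) E |
                   exists2 l, (l <= c)%N & entry_events (p l) E]] >>.

(* F^k, and for k > 0, F^(k - 1/2) *)
Definition F_ (k : nat) := history k k k.
Definition Fhalf (k : nat) := history k k.-1 k.-1.

Record xrego_process : Prop := XRego {
  xrego_p_measurable : forall k, measurable_mx (p k);
  xrego_p_cube : forall k w, cube (p k w);
  xrego_A_gaussian : forall k, (0 < k)%N -> gaussian_mx P (A k);
  xrego_A_independent : forall k, (0 < k)%N ->
    independent P <<s entry_events (A k) >> (F_ k.-1);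
  xrego_y_measurable : forall k, (0 < k)%N -> measurable_mx (y k);
  xrego_y_feasible : forall k w, (0 < k)%N ->
    rp_feasible (A k w) (p k.-1 w) (y k w) }.

Definition iterate (k : nat) (w : T) : 'cV[R]_D := A k w *m y k w + p k.-1 w.

(* Ties between the iterates may be broken in any way. *)
Definition best_iterate (xopt : nat -> T -> 'cV[R]_D) : Prop :=
  forall k w, (0 < k)%N ->
    (exists2 l, (0 < l <= k)%N & xopt k w = iterate l w) /\
    forall l, (0 < l <= k)%N -> f (xopt k w) <= f (iterate l w).

Definition S_ (lam : R) (k : nat) : T -> R :=
  \1_[set w | f (iterate k w) <= rp_min f (A k w) (p k.-1 w) + lam].

End XREGO.

(* For every p in the cube and every D x d Gaussian matrix A, on any
   probability space, the reduced problem is eta-successful with probability at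
   least tau. *)
Definition success_prob_ge {R : realType} {D : nat} (f : 'cV[R]_D -> R)
    (d : nat) (eta tau : R) : Prop :=
  forall (disp : measure_display) (T : measurableType disp)
    (P : probability T R) (A : T -> 'M[R]_(D, d)) (p : 'cV[R]_D),
    gaussian_mx P A -> cube p ->
    (tau%:E <= P [set w | rp_successful f (A w) p eta])%E.

(* Main.v *)
(* With y = e_1 the point A y + p is the first column of A shifted by p, a
   standard Gaussian vector with mean p.  By continuity there is a small box
   inside the cube and near the minimizer on which f <= f* + (eps - lam); all
   its translates by -p stay in a fixed bounded region, so the Gaussian density
   bounds from below, uniformly in p, the probability of hitting the box.  This
   is tau.  (For d = 0 the function f is constant.)

   Let B_k be the event that none of x^1, ..., x^k lies in G_eps, and R the
   event that the k-th reduced problem is (eps - lam)-successful.  As B_(k-1) and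
   p^(k-1) are known at time k - 1 and A^k is independent of the past, Fubini
   gives P(B_(k-1) /\ R) >= tau P(B_(k-1)); conditioning on F^(k-1/2) then gives
   P(B_(k-1) /\ R /\ S^k = 1) >= rho tau P(B_(k-1)), and on that event x^k is in
   G_eps.  Hence P(B_k) <= (1 - tau rho)^k <= exp(- tau rho k). *)
Require Import Defs.
From mathcomp Require Import all_boot all_order all_algebra.
From mathcomp Require Import all_classical all_reals all_analysis.
From mathcomp Require Import measurable_realfun.
From mathcomp Require Import ring lra.
Import Order.TTheory GRing.Theory Num.Theory.
Import numFieldTopology.Exports numFieldNormedType.Exports.
Local Open Scope classical_set_scope.
Local Open Scope ring_scope.

(** * Continuity of matrix-valued maps and approximation by rational matrices *)

Lemma continuous_sum_fun {R : realType} (X : topologicalType) (I : Type)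
    (s : seq I) (F : I -> X -> R) :
  (forall i, continuous (F i)) -> continuous (fun x => \sum_(i <- s) F i x).
Proof.
move=> cF x; elim: s => [|i s IHs].
  by under eq_fun do rewrite big_nil; exact: cst_continuous.
under eq_fun do rewrite big_cons.
by apply: cvgD; [exact: cF|exact: IHs].
Qed.

Lemma mx_continuous {R : realType} (X : topologicalType) m n
    (F : X -> 'M[R]_(m, n)) :
  (forall i j, continuous (fun x => F x i j)) -> continuous F.
Proof.
move=> cF x; apply/cvgrPdist_lt => e e0.
near=> y; suff : ball (F x) e (F y) by rewrite mx_norm_ball.
split=> // i j.
suff /(_ (i, j)) : forall ij : 'I_m * 'I_n,
  ball (F x ij.1 ij.2) e (F y ij.1 ij.2) by [].
near: y; apply: filter_forall => -[i' j'] /=.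
have /cvgrPdist_lt /(_ _ e0) := cF i' j' x; exact.
Unshelve. all: by end_near. Qed.

Lemma continuous_mulmx_trmx {R : realType} D d (M : 'M[R]_(D, d))
    (b : 'cV[R]_D) :
  continuous (fun y : 'rV[R]_d => M *m y^T + b).
Proof.
apply: mx_continuous => i j.
have -> : (fun y : 'rV[R]_d => (M *m y^T + b) i j) =
    (fun y => \sum_k M i k * y j k + b i j).
  apply/funext => y; rewrite !mxE; congr (_ + _).
  by apply: eq_bigr => k _; rewrite mxE.
have cM k : continuous (fun y : 'rV[R]_d => M i k * y j k).
  move=> y; apply: (@continuousM _ _ (fun=> M i k)).
    exact: cst_continuous.
  exact: coord_continuous.
move=> y; apply: (@continuousD _ _ _ _ (fun=> b i j)).
  exact: (@continuous_sum_fun _ _ _ (index_enum _) _ cM y).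
exact: cst_continuous.
Qed.

Lemma mx_rat_dense {R : realType} m n (x : 'M[R]_(m, n)) (e : R) : 0 < e ->
  exists q : 'M[rat]_(m, n), `|x - map_mx ratr q| < e.
Proof.
move=> e0; have H i j : exists q : rat, `|x i j - ratr q| < e.
  have [|q] := @rat_in_itvoo R (x i j - e) (x i j + e).
    by rewrite ltrD2l gtrN.
  by rewrite in_itv/= => /andP[xq qx]; exists q; rewrite distrC ltr_distl xq.
have /choice[q Hq] : forall ij : 'I_m * 'I_n, exists q : rat,
    `|x ij.1 ij.2 - ratr q| < e by move=> [i j]; exact: H.
exists (\matrix_(i, j) q (i, j)).
have : ball x e (map_mx ratr (\matrix_(i, j) q (i, j))).
  by split=> // i j; rewrite !mxE; exact: (Hq (i, j)).
by rewrite mx_norm_ball.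
Qed.

(* Compactness turns the existence of a zero into conditions on rational
   points only, which makes it measurable in parameters. *)
Lemma exists_le0_rat {R : realType} d (h : 'rV[R]_d -> R) : continuous h ->
  (exists y, h y <= 0) <->
  exists N : nat, forall m : nat, exists q : 'rV[rat]_d,
    `|map_mx ratr q : 'rV[R]_d| <= N%:R /\ h (map_mx ratr q) < m.+1%:R^-1.
Proof.
move=> ch; split=> [[y hy]|[N HN]].
  (* A rational point within distance 1 of [y] has norm at most [|y| + 1], so the radius can be
     fixed before [m] is given. *)
  exists (Num.truncn (`|y| + 1)).+1 => m.
  have m0 : (0 : R) < m.+1%:R^-1 by rewrite invr_gt0.
  have /cvgrPdist_lt /(_ _ m0) := ch y.
  move=> /nbhs_ballP [e /= e0]; rewrite -ball_normE => eh.
  have [|q yq] := @mx_rat_dense _ _ _ y (Num.min e 1).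
    by rewrite lt_min e0 ltr01.
  move: yq; rewrite lt_min => /andP[yqe yq1].
  exists q; split.
    apply: (@le_trans _ _ (`|y| + 1)); last exact/ltW/truncnS_gt.
    rewrite -[map_mx _ _](subKr y) (le_trans (ler_normB _ _))// lerD2l.
    exact: ltW.
  have := eh _ yqe; rewrite /= distrC => /(le_lt_trans (ler_norm _)).
  by rewrite ltrBlDr => /lt_le_trans; apply; rewrite gerDl.
pose B := [set y : 'rV[R]_d | `|y| <= N%:R].
have B0 : B !=set0 by have [q []] := HN 0; exists (map_mx ratr q).
have cB : compact B.
  apply: bounded_closed_compact.
    exists N%:R; split=> // x xN y /= yB; exact: le_trans yB (ltW xN).
  rewrite (_ : B = Num.norm @^-1` [set t : R | t <= N%:R])//.
  apply: preimage_closed; last exact: closed_le.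
  by move=> x _; exact: norm_continuous.
have [|c cinB cmin] := compact_EVT_min (f := h) B0 cB.
  by apply: continuous_subspaceT => x; exact: ch.
exists c; rewrite leNgt; apply/negP => hc0.
(* This index makes [m.+1%:R^-1 < h c], so [q] would undercut the minimum of [h] over the compact
   ball [B]. *)
have [q [qB qh]] := HN (Num.truncn (h c)^-1).
have := cmin _ (mem_set qB); apply/negP; rewrite -ltNge (lt_trans qh)//.
by rewrite invf_plt ?posrE//; exact: truncnS_gt.
Qed.

(** * Measurability of events defined by random matrices *)

Lemma measurable_mx_open {R : realType} disp (T : measurableType disp) m n
    (M : T -> 'M[R]_(m, n)) (O : set 'M[R]_(m, n)) :
  measurable_mx M -> open O -> measurable (M @^-1` O).
Proof.
move=> mM oO.
(* An open set is the union of the countably many balls with rational centre and radius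
   [1 / (k + 1)] that it contains. A ball of the sup norm is a finite intersection of conditions on
   single entries, which gives [F]. *)
pose D := [set qk : 'M[rat]_(m, n) * nat |
  ball (map_mx ratr qk.1 : 'M[R]_(m, n)) qk.2.+1%:R^-1 `<=` O].
pose F (qk : 'M[rat]_(m, n) * nat) :=
  \bigcap_(ij : 'I_m * 'I_n) [set w |
    ball (ratr (qk.1 ij.1 ij.2) : R) qk.2.+1%:R^-1 (M w ij.1 ij.2)].
rewrite (_ : M @^-1` O = \bigcup_(qk in D) F qk).
  rewrite bigcup_mkcond; apply: countable_bigcupT_measurable => // qk.
  case: ifPn => // _; apply: fin_bigcap_measurable => // -[i j] _ /=.
  rewrite -[X in measurable X]setTI.
  apply: (mM i j measurableT (ball (ratr (qk.1 i j) : R) qk.2.+1%:R^-1)).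
  by apply: open_measurable; apply: ball_open; rewrite invr_gt0.
apply/seteqP; split=> w /=; last first.
  move=> [[q k] /= qkO Fw]; apply: qkO; split; first by rewrite invr_gt0.
  by move=> i j; rewrite mxE; exact: (Fw (i, j)).
move=> OMw; have /nbhs_ballP[e /= e0 eO] : nbhs (M w) O by exact: open_nbhs_nbhs.
pose k := Num.truncn (e / 2)^-1.
have ke : k.+1%:R^-1 < e / 2.
  by rewrite invf_plt ?posrE ?divr_gt0//; exact: truncnS_gt.
have [|q Mq] := @mx_rat_dense _ _ _ (M w) k.+1%:R^-1; first by rewrite invr_gt0.
have {}Mq : ball (map_mx ratr q : 'M[R]_(m, n)) k.+1%:R^-1 (M w).
  by apply: ball_sym; rewrite mx_norm_ball.
exists (q, k) => /=.
  move=> x qx; apply: eO.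
  exact: ball_splitr (le_ball (ltW ke) Mq) (le_ball (ltW ke) qx).
by move=> [i j] _ /=; case: Mq => _ /(_ i j); rewrite mxE.
Qed.

Lemma measurable_mx_lt {R : realType} disp (T : measurableType disp) m n
    (M : T -> 'M[R]_(m, n)) (g : 'M[R]_(m, n) -> R) (c : R) :
  measurable_mx M -> continuous g -> measurable [set w | g (M w) < c].
Proof.
move=> mM cg.
apply: (@measurable_mx_open _ _ _ _ _ M (g @^-1` [set t | t < c])) => //.
by apply: open_comp; [move=> x _; exact: cg|exact: open_lt].
Qed.

Lemma measurable_mx_le {R : realType} disp (T : measurableType disp) m n
    (M : T -> 'M[R]_(m, n)) (g : 'M[R]_(m, n) -> R) (c : R) :
  measurable_mx M -> continuous g -> measurable [set w | g (M w) <= c].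
Proof.
move=> mM cg; rewrite -[X in measurable X]setCK; apply: measurableC.
rewrite (_ : ~` _ = M @^-1` (g @^-1` [set t | c < t])).
  apply: measurable_mx_open => //.
  by apply: open_comp; [move=> x _; exact: cg|exact: open_gt].
by apply/seteqP; split=> w /=; rewrite ltNge => /negP.
Qed.

Lemma measurable_mx_cst {R : realType} disp (T : measurableType disp) m n
    (M : 'M[R]_(m, n)) : measurable_mx (fun _ : T => M).
Proof. by move=> i j; exact: measurable_cst. Qed.

Lemma measurable_mx_affine {R : realType} disp (T : measurableType disp) D d
    (A : T -> 'M[R]_(D, d)) (y : T -> 'cV[R]_d) (p : T -> 'cV[R]_D) :
  measurable_mx A -> measurable_mx y -> measurable_mx p ->
  measurable_mx (fun w => A w *m y w + p w).
Proof.
move=> mA my mp i j; under eq_fun do rewrite !mxE.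
apply: measurable_funD; last exact: mp.
by apply: measurable_sum => k; apply: measurable_funM; [exact: mA|exact: my].
Qed.

(** Lets feasibility be expressed by one continuous inequality. *)
Lemma cube_norm {R : realType} D (x : 'cV[R]_D) : cube x <-> `|x| <= 1.
Proof.
rewrite /Num.Def.normr /= mx_normrE; split=> [xc|/bigmax_leP[_ H] i].
  apply/bigmax_leP; split=> // -[i j] _ /=.
  by rewrite (ord1 j) ler_norml; exact: xc.
by have := H (i, 0) isT; rewrite ler_norml.
Qed.

Lemma continuous_maxr {R : realType} (X : topologicalType) (a b : X -> R) :
  continuous a -> continuous b -> continuous (fun x => Num.max (a x) (b x)).
Proof.
move=> ca cb; under eq_fun do rewrite maxr_absE.
move=> x.
apply: (@continuousM _ _ (fun x => a x + b x + `|a x - b x|) (fun=> _)).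
  apply: (@continuousD _ _ _ (fun x => a x + b x)).
    exact: (continuousD (ca x) (cb x)).
  apply: (@continuous_comp _ _ _ (fun x => a x - b x) Num.norm).
    exact: (continuousB (ca x) (cb x)).
  exact: norm_continuous.
exact: cst_continuous.
Qed.

(** Success quantifies over uncountably many [y]. Feasibility and the bound on [f] are merged into
    [g <= 0] with [g] a continuous maximum, and [exists_le0_rat] then leaves only countable unions
    and intersections. *)
Lemma measurable_rp_successful {R : realType} disp (T : measurableType disp)
    D d (f : 'cV[R]_D -> R) (A : T -> 'M[R]_(D, d)) (p : T -> 'cV[R]_D)
    (eta : R) :
  continuous f -> measurable_mx A -> measurable_mx p ->
  measurable [set w | rp_successful f (A w) (p w) eta].
Proof.
move=> cf mA mp.
pose g x := Num.max (f x - (fmin f + eta)) (`|x| - 1).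
have cg : continuous g.
  apply: continuous_maxr => x.
    exact: (continuousB (cf x) (@cst_continuous _ _ (fmin f + eta) x)).
  exact: (continuousB (@norm_continuous _ _ x) (@cst_continuous _ _ (1 : R) x)).
rewrite (_ : [set w | _] = \bigcup_(N : nat) \bigcap_(m : nat)
    \bigcup_(q in [set q : 'rV[rat]_d | `|map_mx ratr q : 'rV[R]_d| <= N%:R])
    [set w | g (A w *m (map_mx ratr q)^T + p w) < m.+1%:R^-1]).
  apply: bigcupT_measurable => N; apply: bigcapT_measurable => m.
  rewrite bigcup_mkcond; apply: countable_bigcupT_measurable => // q.
  case: ifPn => // _; apply: measurable_mx_lt => //.
  by apply: measurable_mx_affine => //; exact: measurable_mx_cst.
have success w : rp_successful f (A w) (p w) eta <->
    exists y : 'rV[R]_d, g (A w *m y^T + p w) <= 0.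
  split=> [[y yc fy]|[y]].
    exists y^T; rewrite trmxK ge_max !subr_le0 fy.
    by have /cube_norm := yc.
  by rewrite ge_max !subr_le0 => /andP[fy /cube_norm yc]; exists y^T.
have cgA w : continuous (fun y : 'rV[R]_d => g (A w *m y^T + p w)).
  move=> y.
  apply: (@continuous_comp _ _ _ (fun y : 'rV[R]_d => A w *m y^T + p w)).
    exact: continuous_mulmx_trmx.
  exact: cg.
apply/seteqP; split=> w /=.
  move=> /success /(exists_le0_rat _ _ (cgA w))[N HN]; exists N => // m _.
  by have [q [qN qm]] := HN m; exists q.
move=> [N _ HN]; apply/success/(exists_le0_rat _ _ (cgA w)); exists N => m.
by have [q qN qm] := HN m I; exists q.
Qed.

(** * Independence and Fubini *)

Section diagonal.
Context {R : realType} disp (T : measurableType disp) (P : probability T R).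
Variables (G1 G2 : set (set T)).
Hypotheses (mG1 : <<s G1 >> `<=` measurable) (mG2 : <<s G2 >> `<=` measurable).

Let S1 := g_sigma_algebraType G1.
Let S2 := g_sigma_algebraType G2.

(* Under independence the diagonal image of P is the product of the
   restrictions of P to the two sigma-algebras. *)
Lemma independent_diagonal_ge (X : set (S1 * S2)) (E : set T) (tau : R) :
  independent P <<s G1 >> <<s G2 >> ->
  measurable X -> <<s G1 >> E -> 0 <= tau ->
  (forall w1, E w1 -> tau%:E <= P [set w2 | X (w1, w2)])%E ->
  (tau%:E * P E <= P (E `&` [set w | X (w, w)]))%E.
Proof.
move=> indep mX GE tau0 sec.
have m1 : measurable_fun setT (fun w : T => w : S1).
  by move=> _ B mB; rewrite setTI; exact: mG1.
have m2 : measurable_fun setT (fun w : T => w : S2).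
  by move=> _ B mB; rewrite setTI; exact: mG2.
have m12 : measurable_fun setT (fun w : T => (w : S1, w : S2)).
  exact: measurable_fun_pair.
pose X1 := mfun_Sub (mem_set m1); pose X2 := mfun_Sub (mem_set m2).
pose X12 := mfun_Sub (mem_set m12).
have diag B : measurable B ->
    (distribution P X1 \x distribution P X2)%E B = distribution P X12 B.
  apply: product_measure_unique => B1 B2 mB1 mB2.
  exact: indep.
have mE : measurable (E : set S1) by [].
have mEX : measurable ((E : set S1) `*` setT `&` X).
  by apply: measurableI => //; exact: measurableX.
have := diag _ mEX.
rewrite [RHS]/distribution /pushforward /= => EX.
rewrite (_ : E `&` _ =
    (fun w : T => (w : S1, w : S2)) @^-1` (E `*` setT `&` X)); last first.
  apply/seteqP; split=> w /= -[]; first by move=> Ew Xw; split.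
  by move=> [Ew _] Xw; split.
rewrite -[leRHS]EX /product_measure1.
rewrite -[P E]/(distribution P X1 E) -integral_cst//.
have mf := @measurable_fun_xsection _ _ _ _ _ (distribution P X2) _ mEX.
(* The sections are empty off [E], and over [E] they are the sections of [X], to which [sec]
   applies. *)
apply: (@le_trans _ _ (\int[distribution P X1]_(x in E)
    (distribution P X2 \o xsection (E `*` setT `&` X)) x)%E); last first.
  by apply: ge0_subset_integral => // x _ /=; exact: measure_ge0.
apply: ge0_le_integral => //.
- exact: measurable_funTS.
- move=> w Ew /=; apply: le_trans (sec _ Ew) _.
  rewrite [leRHS]/(P _) le_eqVlt; apply/orP; left; apply/eqP; congr (P _).
  apply/seteqP; split=> z /=; first by move=> Xz; apply/mem_set.
  by move=> /set_mem /= [].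
Qed.

End diagonal.

(** * A success probability uniform in the base point *)

Lemma normal_prob_itv_ge {R : realType} (s : R) : 0 < s -> s <= 1 ->
  exists2 c : R, 0 < c & forall a : R, `|a| <= 2 ->
    (c%:E <= normal_prob 0 1 `[(a - s)%R, (a + s)%R]%classic)%E.
Proof.
move=> s0 s1; have one0 : (1 : R) != 0 by exact: oner_neq0.
have pdf3 : 0 < normal_pdf (0 : R) 1 3.
  by rewrite normal_pdfE// mulr_gt0 ?expR_gt0 ?normal_peak_gt0.
(* The interval has length [2 s] and lies in [[-3, 3]], where the density is at least its value at
   3. *)
exists (normal_pdf 0 1 3 * (s *+ 2)); first by rewrite mulr_gt0// pmulrn_lgt0.
move=> a; rewrite ler_norml => /andP[a1 a2].
have asE : (s *+ 2)%:E = lebesgue_measure `[a - s, a + s]%classic.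
  rewrite lebesgue_measure_itv/= lte_fin ltrD2l gtrN// -EFinB.
  by congr EFin; rewrite mulr2n; ring.
rewrite EFinM asE -integral_cst//; apply: ge0_le_integral => //=.
- by move=> x _; rewrite lee_fin; exact: normal_pdf_ge0.
- apply/measurable_EFinP; apply: measurable_funTS; exact: measurable_normal_pdf.
move=> x; rewrite in_itv/= => /andP[x1 x2].
rewrite lee_fin !normal_pdfE//; apply: ler_wpM2l; first exact: normal_peak_ge0.
rewrite /normal_fun ler_expR !subr0 ler_wpM2r ?invr_ge0 ?mulrn_wge0 ?sqr_ge0//.
by rewrite lerN2; nra.
Qed.

Lemma fminE {R : realType} {D} {f : 'cV[R]_D -> R} {xs : 'cV[R]_D} :
  global_minimizer f xs -> fmin f = f xs.
Proof.
move=> [cxs mxs]; apply/eqP; rewrite eq_le; apply/andP; split.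
  apply: ge_inf; last by exists xs.
  by exists (f xs) => _ [x cx <-]; exact: mxs.
apply: lb_le_inf; first by exists (f xs), xs.
by move=> _ [x cx <-]; exact: mxs.
Qed.

Lemma prode_ge_expr {R : realType} n (c : R) (F : 'I_n -> \bar R) : 0 <= c ->
  (forall i, c%:E <= F i)%E -> ((c ^+ n)%:E <= \prod_(i < n) F i)%E.
Proof.
move=> c0; elim: n F => [|n IHn] F cF; first by rewrite big_ord0.
rewrite big_ord_recl exprS EFinM; apply: lee_pmul => //.
- by rewrite lee_fin exprn_ge0.
- by apply: IHn => i.
Qed.

(** Independence of the entries turns the probability into a product over the rows, the other
    columns contributing factors 1. The one-dimensional bound [c] yields [c ^+ D] for all [P], [A]
    and [a] at once. *)
Lemma gaussian_mx_col_box {R : realType} D d (s : R) : 0 < s -> s <= 1 ->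
  exists2 tau : R, 0 < tau & forall disp (T : measurableType disp)
    (P : probability T R) (A : T -> 'M[R]_(D, d.+1)) (a : 'I_D -> R),
    gaussian_mx P A -> (forall i, `|a i| <= 2) ->
    measurable [set w | forall i, a i - s <= A w i 0 <= a i + s] /\
    (tau%:E <= P [set w | (forall i, a i - s <= A w i 0 <= a i + s)%R])%E.
Proof.
move=> s0 s1; have [c c0 Hc] := normal_prob_itv_ge s s0 s1.
exists (c ^+ D); first exact: exprn_gt0.
move=> disp T P A a [mA gA iA] a2.
pose B (i : 'I_D) (j : 'I_d.+1) : set R :=
  if j == 0 then `[a i - s, a i + s]%classic else setT.
have mB i j : measurable (B i j) by rewrite /B; case: ifP.
have BE : [set w | forall i, a i - s <= A w i 0 <= a i + s] =
    [set w | forall i j, B i j (A w i j)].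
  apply/seteqP; split=> w /= H i; last first.
    by have := H i 0; rewrite /B eqxx /= in_itv.
  by move=> j; rewrite /B; case: eqP => // -> /=; rewrite in_itv/= H.
rewrite BE; split.
  rewrite (_ : [set w | _] = \bigcap_(ij : 'I_D * 'I_d.+1)
      (fun w => A w ij.1 ij.2) @^-1` B ij.1 ij.2).
    apply: fin_bigcap_measurable => // -[i j] _.
    by rewrite -[X in measurable X]setTI; exact: mA.
  apply/seteqP; split=> w /= H; first by move=> [i j] _; exact: H.
  by move=> i j; exact: (H (i, j)).
rewrite iA//; apply: prode_ge_expr; first exact: ltW.
move=> i; rewrite big_ord_recl big1 ?mule1.
  by rewrite gA// /B eqxx; exact: Hc.
move=> j _; rewrite (_ : [set w | _] = setT) ?probability_setT//.
Qed.

Lemma success_prob_ge_exists {R : realType} D d (f : 'cV[R]_D -> R)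
    (xs : 'cV[R]_D) (eta : R) :
  continuous f -> global_minimizer f xs -> 0 < eta ->
  exists tau : R, [/\ 0 < tau, tau <= 1 & success_prob_ge f d.+1 eta tau].
Proof.
move=> cf xsmin eta0; have [cxs _] := xsmin.
have [e /= e0 He] : exists2 e : R, 0 < e &
    forall x, `|xs - x| < e -> f x <= fmin f + eta.
  have /cvgrPdist_lt /(_ _ eta0) /nbhs_ballP[e /= e0 He] := cf xs.
  exists e => // x xsx; have /He /= : ball xs e x by rewrite mx_norm_ball.
  rewrite (fminE xsmin) distrC => /(le_lt_trans (ler_norm _))/ltW.
  by rewrite lerBlDl.
(* The target box has centre [(1 - s) xs] and half-width [s]. Shrinking the centre towards 0 keeps
   the box in the cube, and its points are within [2 s < e] of [xs]. *)
pose s := Num.min 1 (e / 3).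
have s0 : 0 < s by rewrite lt_min ltr01 divr_gt0.
have s1 : s <= 1 by rewrite ge_min lexx.
have se : s *+ 2 < e.
  apply: (@le_lt_trans _ _ ((e / 3) *+ 2)); last by rewrite -mulr_natr; lra.
  by rewrite lerMn2r ge_min lexx orbT.
have [tau tau0 Htau] := @gaussian_mx_col_box R D d s s0 s1.
exists (Num.min 1 tau); split; first by rewrite lt_min ltr01.
  by rewrite ge_min lexx.
move=> disp T P A p gA cp.
pose a i := (1 - s) * xs i 0 - p i 0.
have [i|mbox Pbox] := Htau _ _ P A a gA.
  have /andP[x1 x2] := cxs i; have /andP[p1 p2] := cp i.
  by rewrite ler_norml /a; nra.
apply: (@le_trans _ _ (P [set w | (forall i, a i - s <= A w i 0 <= a i + s)%R])).
  by apply: le_trans Pbox; rewrite lee_fin ge_min lexx orbT.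
apply: le_measure; rewrite ?inE//.
  apply: (@measurable_rp_successful _ _ _ _ _ f A (fun=> p)) => //; by case: gA.
move=> w /= Aw; exists (delta_mx 0 0).
  move=> i; rewrite -colE !mxE; have /andP[] := Aw i; rewrite /a => A1 A2.
  have /andP[x1 x2] := cxs i; apply/andP; split; nra.
apply: He; suff : ball xs e (A w *m delta_mx 0 0 + p) by rewrite mx_norm_ball.
split=> // i j; rewrite (ord1 j) /ball/= -colE !mxE.
apply: le_lt_trans se; have /andP[] := Aw i; rewrite /a => A1 A2.
by have /andP[x1 x2] := cxs i; rewrite ler_norml mulr2n; apply/andP; split; nra.
Qed.

(** The integral of a nonnegative function is the supremum over the simple functions below it, so
    comparing these suffices. This is meant for the indicator [S_], whose measurability is not
    established. *)
Lemma integral_le_measure {R : realType} disp (T : measurableType disp)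
    (mu : {measure set T -> \bar R}) (D B : set T) (f : T -> \bar R) :
  measurable B -> (forall w, D w -> 0 <= f w)%E ->
  (forall w, D w -> f w <= (\1_B w)%:E)%E ->
  (\int[mu]_(w in D) f w <= mu B)%E.
Proof.
move=> mB f0 fB; rewrite -[B in leRHS]setIT -integral_indic//.
rewrite ge0_integralE// ge0_integralTE//.
apply: ereal_sup_le => _ [h hf <-]; exists h => // w.
apply: le_trans (hf w) _; rewrite patchE.
case: ifPn => [/set_mem|_]; first exact: fB.
by rewrite lee_fin.
Qed.

(** * The sigma-algebras generated by the past *)

Section history.
Context {R : realType} {disp : measure_display} {T : measurableType disp}.
Context {D d : nat}.
Variables (A : nat -> T -> 'M[R]_(D, d)) (y : nat -> T -> 'cV[R]_d)
          (p : nat -> T -> 'cV[R]_D).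

(** The generating family of [history], named so that [g_sigma_algebraType] can make a measurable
    type of it. *)
Definition history_gen (a b c : nat) : set (set T) :=
  [set E | [\/ exists2 l, (0 < l <= a)%N & entry_events (A l) E,
               exists2 l, (0 < l <= b)%N & entry_events (y l) E |
               exists2 l, (l <= c)%N & entry_events (p l) E]].

Lemma entry_events_mx_measurable m n (M : T -> 'M[R]_(m, n)) (G : set (set T)) :
  entry_events M `<=` G ->
  measurable_mx (M : g_sigma_algebraType G -> 'M[R]_(m, n)).
Proof.
move=> MG i j _ B mB; apply: sub_sigma_algebra; apply: MG.
by exists i => //; exists j => //; exists B.
Qed.

Lemma entry_events_measurable m n (M : T -> 'M[R]_(m, n)) :
  measurable_mx M -> entry_events M `<=` measurable.
Proof.
by move=> mM _ [i _ [j _ [B mB <-]]]; exact: mM.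
Qed.

Lemma sub_history a b c a' b' c' :
  (a <= a')%N -> (b <= b')%N -> (c <= c')%N ->
  history A y p a b c `<=` history A y p a' b' c'.
Proof.
move=> aa bb cc; apply: sub_sigma_algebra2 => E [] [l].
- move=> /andP[l0 la] El; apply: Or31; exists l => //.
  by rewrite l0 (leq_trans la).
- move=> /andP[l0 la] El; apply: Or32; exists l => //.
  by rewrite l0 (leq_trans la).
- by move=> lc El; apply: Or33; exists l => //; exact: leq_trans cc.
Qed.

End history.

(** * One step of the process and geometric decay of the failure probability *)

Section process.
Context {R : realType} {disp : measure_display} {T : measurableType disp}.
Context {D d : nat}.
Variables (P : probability T R) (f : 'cV[R]_D -> R).
Variables (A : nat -> T -> 'M[R]_(D, d)) (y : nat -> T -> 'cV[R]_d)
          (p : nat -> T -> 'cV[R]_D).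
Variables (xs : 'cV[R]_D) (eps lam rho tau : R).
Hypotheses (f_continuous : continuous f) (xs_minimizer : global_minimizer f xs)
  (process : xrego_process P A y p)
  (S_ge_rho : forall k, (0 < k)%N ->
     exists2 Y : T -> R,
       is_cond_exp P (Fhalf A y p k) (S_ f A y p lam k) Y &
       {ae P, forall w, rho <= Y w})
  (rho_gt0 : 0 < rho) (rho_le1 : rho <= 1)
  (tau_gt0 : 0 < tau) (tau_le1 : tau <= 1)
  (tau_success : success_prob_ge f d (eps - lam) tau).

Lemma history_measurable a b c : history A y p a b c `<=` measurable.
Proof.
apply: smallest_sub; first exact: sigma_algebra_measurable.
case: process => mp _ gA _ my _ E [] [l].
- by move=> /andP[/gA[mA _ _] _]; exact: entry_events_measurable.
- by move=> /andP[/my mY _]; exact: entry_events_measurable.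
- by move=> _; exact: entry_events_measurable.
Qed.

(** The event B_k. Membership in the cube is left out because every iterate is feasible. *)
Definition all_bad (k : nat) : set T :=
  [set w | forall l, (0 < l <= k)%N -> fmin f + eps < f (iterate A y p l w)].

Lemma all_bad_F k : F_ A y p k (all_bad k).
Proof.
(* Taking F^k as the sigma-algebra of the underlying type turns membership in it into plain
   measurability. *)
pose S := g_sigma_algebraType (history_gen A y p k k k).
rewrite (_ : all_bad k = \bigcap_(l : nat)
    [set w | (0 < l <= k)%N -> fmin f + eps < f (iterate A y p l w)]);
  last first.
  by apply/seteqP; split=> w /= H l; [move=> _; exact: H|exact: H].
apply: (@bigcapT_measurable _ S) => l.
have [/andP[l0 lk]|nlk] := boolP (0 < l <= k)%N; last first.
  rewrite (_ : [set w | _] = setT); first exact: measurableT.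
  by apply/seteqP; split.
have miter : measurable_mx (iterate A y p l : S -> _).
  apply: measurable_mx_affine; apply: entry_events_mx_measurable => E El.
  - by apply: Or31; exists l => //; rewrite l0.
  - by apply: Or32; exists l => //; rewrite l0.
  - by apply: Or33; exists l.-1 => //; apply: leq_trans lk; exact: leq_pred.
have := measurableC (@measurable_mx_le _ _ S _ _ (iterate A y p l) f
  (fmin f + eps) miter f_continuous).
congr (measurable _); apply/seteqP; split=> w /=.
  by move=> H _; rewrite ltNge; apply/negP.
by move=> /(_ isT); rewrite ltNge => /negP.
Qed.

Let success k : set T :=
  [set w | rp_successful f (A k.+1 w) (p k w) (eps - lam)].

Let good k : set T := [set w | f (iterate A y p k.+1 w) <= fmin f + eps].

Lemma good_measurable k : measurable (good k).
Proof.
apply: measurable_mx_le => //; case: process => mp _ gA _ my _.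
by apply: measurable_mx_affine => //; [case: (gA k.+1)|exact: my].
Qed.

Lemma success_Fhalf k : Fhalf A y p k.+1 (success k).
Proof.
pose S := g_sigma_algebraType (history_gen A y p k.+1 k k).
apply: (@measurable_rp_successful _ _ S _ _ f (A k.+1) (p k)) => //;
  apply: entry_events_mx_measurable => E El.
  by apply: Or31; exists k.+1 => //; rewrite leqnn.
by apply: Or33; exists k.
Qed.

(** In [X] the first coordinate carries the past and the second the new matrix. Once the past is
    frozen, [p k] is a fixed point of the cube and [tau_success] bounds the section. *)
Lemma success_prob k E : F_ A y p k E ->
  (tau%:E * P E <= P (E `&` success k))%E.
Proof.
move=> FE; case: process => mp cp gA iA my yf.
pose S1 := g_sigma_algebraType (history_gen A y p k k k).
pose S2 := g_sigma_algebraType (entry_events (A k.+1)).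
pose X : set (S1 * S2) :=
  [set w | rp_successful f (A k.+1 w.2) (p k w.1) (eps - lam)].
apply: (@independent_diagonal_ge _ _ _ P (history_gen A y p k k k)
    (entry_events (A k.+1)) _ _ X) => //.
- exact: history_measurable.
- apply: smallest_sub; first exact: sigma_algebra_measurable.
  by apply: entry_events_measurable; have [] := gA k.+1.
- by move=> E1 E2 G1 G2; rewrite setIC muleC; exact: (iA k.+1).
- apply: (@measurable_rp_successful _ _ _ _ _ f (fun w : S1 * S2 => A k.+1 w.2)
      (fun w : S1 * S2 => p k w.1)) => // i j.
    apply: (@measurableT_comp _ _ _ _ _ _ (fun w : S2 => A k.+1 w i j)) => //.
    exact: (@entry_events_mx_measurable _ _ _ _ _ (A k.+1)).
  apply: (@measurableT_comp _ _ _ _ _ _ (fun w : S1 => p k w i j)) => //.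
  apply: (@entry_events_mx_measurable _ _ _ _ _ (p k)
    (history_gen A y p k k k)) => E' HE'.
  by apply: Or33; exists k.
- exact: ltW.
- move=> w _.
  exact: (tau_success _ _ P (A k.+1) (p k w) (gA k.+1 isT) (cp k w)).
Qed.

(** On [E] the reduced minimum is at most [fmin f + (eps - lam)], so solving to accuracy [lam]
    reaches [fmin f + eps]. Since [E] is known before [y] is drawn, integrating the conditional
    expectation over it gives the factor [rho]. *)
Lemma solve_prob k E : Fhalf A y p k.+1 E -> E `<=` success k ->
  (rho%:E * P E <= P (E `&` good k))%E.
Proof.
move=> FE Esucc; have [Y [mY iY EY] Yrho] := S_ge_rho k.+1 isT.
have mE : measurable E by exact: history_measurable FE.
apply: (@le_trans _ _ (\int[P]_(w in E) (S_ f A y p lam k.+1 w)%:E)%E).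
  rewrite -EY// -integral_cst//.
  have mYT : measurable_fun E (EFin \o Y).
    by apply: measurable_funTS; case/integrableP : iY.
  (* [Z] equals [Y] almost everywhere but is at least [rho] everywhere, so pointwise monotonicity of
     the integral applies. *)
  pose Z w := maxe rho%:E (Y w)%:E.
  have mZ : measurable_fun E Z by exact: measurable_maxe.
  rewrite (@ae_eq_integral _ _ _ P E Z (EFin \o Y))//.
    apply: ge0_le_integral => //.
    - by move=> w _; rewrite lee_fin ltW.
    - by move=> w _; rewrite /Z le_max lexx.
  apply: filterS Yrho => w Yw _; rewrite /Z; apply/esym/max_idPr.
  by rewrite lee_fin.
apply: integral_le_measure.
- by apply: measurableI => //; exact: good_measurable.
- by move=> w _; rewrite lee_fin.
move=> w Ew; rewrite lee_fin /S_ !indicE.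
case: (boolP (w \in [set _ | _])) => // /set_mem /= Sw.
rewrite mem_set//; split=> //=.
apply: (le_trans Sw); have [z zf fz] := Esucc _ Ew.
rewrite -[eps](subrK lam) addrA lerD2r; apply: le_trans fz.
(* The value [f xs] bounds the reduced values from below, so the infimum is not a default value. *)
apply: ge_inf; last by exists z.
by exists (f xs) => _ [z' z'f <-]; case: xs_minimizer => _; exact.
Qed.

Lemma all_bad_step k :
  (P (all_bad k.+1) <= (1 - tau * rho)%:E * P (all_bad k))%E.
Proof.
have mbad j : measurable (all_bad j) by exact: history_measurable (all_bad_F j).
have mgood := good_measurable k.
have badS : all_bad k.+1 = all_bad k `\` good k.
  apply/seteqP; split=> w /=.
    move=> H; split; last by rewrite /good /= leNgt H ?leqnn.
    by move=> l /andP[l0 lk]; apply: H; rewrite l0 leqW.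
  rewrite /good /= => -[H /negP]; rewrite -ltNge => Hk l /andP[l0]; rewrite leq_eqVlt.
  by case/orP => [/eqP -> //|lk]; apply: H; rewrite l0.
have step : ((tau * rho)%:E * P (all_bad k) <= P (all_bad k `&` good k))%E.
  rewrite mulrC EFinM -muleA.
  apply: (@le_trans _ _ (rho%:E * P (all_bad k `&` success k))%E).
    apply: lee_pmul => //; first by rewrite lee_fin ltW.
      by rewrite mule_ge0// lee_fin ltW.
    exact: success_prob (all_bad_F k).
  (* Passing from F^k to F^(k+1/2) only adds the entries of [A k.+1], so both events lie in the
     latter. *)
  have FE : Fhalf A y p k.+1 (all_bad k `&` success k).
    apply: (@measurableI _ (g_sigma_algebraType (history_gen A y p k.+1 k k))).
      by apply: (@sub_history _ _ _ _ _ A y p k k k);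
        [exact: leqnSn|..|exact: all_bad_F].
    exact: success_Fhalf.
  apply: le_trans (solve_prob _ _ FE _) _; first by move=> w [].
  apply: le_measure; rewrite ?inE.
  - apply: measurableI => //; exact: history_measurable FE.
  - exact: measurableI.
  - by move=> w [[]].
have -> : P (all_bad k.+1) = (P (all_bad k) - P (all_bad k `&` good k))%E.
  rewrite badS measureD//; exact: le_lt_trans (probability_le1 _ _) (ltry _).
rewrite EFinB muleBl ?fin_num_adde_defr ?fin_num_measure//.
by rewrite [X in (X - (tau * rho)%:E * _)%E]mul1e leeB.
Qed.

Lemma all_bad_prob k : (P (all_bad k) <= ((1 - tau * rho) ^+ k)%:E)%E.
Proof.
have t1 : 0 <= 1 - tau * rho by rewrite subr_ge0 mulr_ile1// ltW.
elim: k => [|k IHk].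
  rewrite expr0.
  exact: probability_le1 (history_measurable _ _ _ _ (all_bad_F 0)).
apply: le_trans (all_bad_step k) _; rewrite exprS EFinM.
by apply: lee_pmul => //; rewrite lee_fin.
Qed.

(** The best iterate is one of the iterates and is no worse than any, so it misses the target
    exactly on [all_bad k]. *)
Lemma best_iterate_prob (xopt : nat -> T -> 'cV[R]_D) k :
  best_iterate f A y p xopt -> (0 < k)%N ->
  [/\ P [set w | Geps f eps (xopt k w)] =
        P [set w | f (xopt k w) <= fmin f + eps],
      ((1 - (1 - tau * rho) ^+ k)%:E <= P [set w | Geps f eps (xopt k w)])%E &
      (P [set w | Geps f eps (xopt k w)] <= 1)%E].
Proof.
move=> best k0.
have mbad : measurable (all_bad k) by exact: history_measurable (all_bad_F k).
have GE : [set w | Geps f eps (xopt k w)] =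
    [set w | f (xopt k w) <= fmin f + eps].
  apply/seteqP; split=> w /=; first by case.
  move=> fx; split=> //; have [[l /andP[l0 _] ->] _] := best k w k0.
  by case: process => _ _ _ _ _; exact.
have fE : [set w | f (xopt k w) <= fmin f + eps] = ~` all_bad k.
  apply/seteqP; split=> w /=.
    have [[l lk ->] _] := best k w k0.
    by move=> H /(_ _ lk); rewrite ltNge H.
  move=> H; rewrite leNgt; apply/negP => bad; apply: H => l lk.
  by have [_ /(_ _ lk)] := best k w k0; exact: lt_le_trans.
rewrite GE; split=> //; rewrite fE.
  by rewrite probability_setC// EFinB leeB// all_bad_prob.
by apply: probability_le1; exact: measurableC.
Qed.

End process.

(** * The case d = 0, the threshold K_xi and the conclusion *)

Lemma success_prob_ge_dim0 {R : realType} D (f : 'cV[R]_D -> R) (xs : 'cV[R]_D)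
    (eta : R) :
  (forall x z, f x = f z) -> global_minimizer f xs -> 0 < eta ->
  success_prob_ge f 0 eta 1.
Proof.
move=> fcst xsmin eta0 disp T P A p _ cp.
rewrite (_ : [set w | _] = setT) ?probability_setT//.
(* The point [y = 0] gives [p] itself, which is optimal because [f] is constant. *)
apply/seteqP; split=> // w _; exists 0.
  by rewrite /rp_feasible /= mulmx0 add0r.
by rewrite (fminE xsmin) (fcst _ xs) lerDl ltW.
Qed.

Lemma effective_subspace0_cst {R : realType} n (f : 'cV[R]_n -> R)
    (T : {vspace 'cV[R]_n}) x z : effective_subspace f 0 T -> f x = f z.
Proof.
move=> [/eqP]; rewrite dimv_eq0 => /eqP -> fT _.
have f0 u : f u = f 0.
  rewrite -[u in LHS]add0r fT ?mem0v// => t; rewrite memv0 => /eqP ->.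
  by rewrite /dotv big1// => i _; rewrite mxE mul0r.
by rewrite !f0.
Qed.

(** Follows from [1 - c <= expR (- c)] raised to the power [k]; with [c = tau * rho] it is the
    origin of K_xi. *)
Lemma onem_expr_le {R : realType} (c xi : R) (k : nat) :
  0 < c -> c <= 1 -> 0 < xi -> xi < 1 -> `|ln (1 - xi)| / c <= k%:R ->
  (1 - c) ^+ k <= 1 - xi.
Proof.
move=> c0 c1 xi0 xi1; rewrite ler_pdivrMr// => H.
have xi1' : 0 < 1 - xi by rewrite subr_gt0.
apply: (@le_trans _ _ (expR (- c) ^+ k)).
  by rewrite lerXn2r ?nnegrE ?subr_ge0 ?expR_ge0// expR_ge1Dx.
rewrite -expRM_natl -[leRHS]lnK ?posrE// ler_expR.
move: H; rewrite ler0_norm; last by rewrite ln_le0// gerBl ltW.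
by rewrite mulrN lerNl.
Qed.

Theorem theorem4p7 (R : realType) (D d de : nat) (f : 'cV[R]_D -> R)
    (T : {vspace 'cV[R]_D}) (U : 'M[R]_(D, de)) (V : 'M[R]_(D, D - de))
    (xs : 'cV[R]_D) (eps lam rho : R)
    (disp : measure_display) (Omega : measurableType disp)
    (P : probability Omega R)
    (A : nat -> Omega -> 'M[R]_(D, d)) (y : nat -> Omega -> 'cV[R]_d)
    (p xopt : nat -> Omega -> 'cV[R]_D)
    (f_continuous : continuous f)
    (de_lt_D : (de < D)%N) (de_le_d : (de <= d)%N)
    (T_effective : effective_subspace f de T)
    (U_basis : orthonormal_basis U [set x | x \in T])
    (V_basis : orthonormal_basis V (orthocomp T))
    (xs_minimizer : global_minimizer f xs)
    (Gstar_nondegenerate : (0 < lebesgue_vol (Gstar_bar U V T xs))%E)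
    (f_lipschitz : lipschitz_euclid f)
    (eps_gt0 : 0 < eps) (lam_gt0 : 0 < lam) (lam_lt_eps : lam < eps)
    (process : xrego_process P A y p)
    (xopt_best : best_iterate f A y p xopt)
    (rho_gt0 : 0 < rho) (rho_le1 : rho <= 1)
    (S_ge_rho : forall k, (0 < k)%N ->
       exists2 Y : Omega -> R,
         is_cond_exp P (Fhalf A y p k) (S_ f A y p lam k) Y &
         {ae P, forall w, rho <= Y w}) :
  [/\ P [set w | Geps f eps (xopt k w)] @[k --> \oo] --> 1%E,
      P [set w | f (xopt k w) <= fmin f + eps] @[k --> \oo] --> 1%E,
      exists tau : R,
        [/\ 0 < tau, tau <= 1 & success_prob_ge f d (eps - lam) tau] &
      forall tau xi : R,
        0 < tau -> tau <= 1 -> success_prob_ge f d (eps - lam) tau ->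
        0 < xi -> xi < 1 ->
        forall k : nat,
          Num.ceil (`|ln (1 - xi)| / (tau * rho)) <= k%:Z ->
          P [set w | Geps f eps (xopt k w)] =
            P [set w | f (xopt k w) <= fmin f + eps] /\
          (xi%:E <= P [set w | Geps f eps (xopt k w)])%E].
Proof.
have eta0 : 0 < eps - lam by rewrite subr_gt0.
have [tau [tau0 tau1 tau_success]] : exists tau : R,
    [/\ 0 < tau, tau <= 1 & success_prob_ge f d (eps - lam) tau].
  case: d => [|d'] in A y de_le_d process xopt_best S_ge_rho *.
    move: de_le_d; rewrite leqn0 => /eqP de0; rewrite de0 in T_effective.
    exists 1; split=> //; apply: (@success_prob_ge_dim0 _ _ f xs) => // x z.
    exact: effective_subspace0_cst T_effective.
  exact: (@success_prob_ge_exists _ _ _ f xs).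
(* The constant [t] stays a parameter: the limits use the [tau] just built, the last claim any
   admissible one. *)
have prob t (t0 : 0 < t) (t1 : t <= 1)
    (ts : success_prob_ge f d (eps - lam) t) k :=
  @best_iterate_prob R disp Omega D d P f A y p xs eps lam rho t f_continuous
    xs_minimizer process S_ge_rho rho_gt0 rho_le1 t0 t1 ts xopt k xopt_best.
have lower1 : (fun k => 1 - (1 - tau * rho) ^+ k) @ \oo --> (1 : R).
  rewrite -[X in _ --> X]subr0; apply: cvgB; first exact: cvg_cst.
  have t1 : 0 <= 1 - tau * rho by rewrite subr_ge0 mulr_ile1// ltW.
  by apply: cvg_expr; rewrite ger0_norm// gtrBl mulr_gt0.
have lim1 : P [set w | Geps f eps (xopt k w)] @[k --> \oo] --> 1%E.
  apply: (@squeeze_cvge _ _ _ _ (fun k => (1 - (1 - tau * rho) ^+ k)%:E) _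
    (fun=> 1%E)).
  - exists 1%N => // k /= k0.
    by have [_ -> ->] := prob _ tau0 tau1 tau_success k k0.
  - by apply: cvg_EFin; [exact: nearW|exact: lower1].
  - exact: cvg_cst.
split=> //.
- apply: cvg_trans lim1; apply: near_eq_cvg; exists 1%N => // k /= k0.
  by have [->] := prob _ tau0 tau1 tau_success k k0.
- by exists tau.
move=> t xi t0 t1 ts xi0 xi1 k; rewrite ceil_le_int => kK.
have tr0 : 0 < t * rho by rewrite mulr_gt0.
(* As [xi > 0], the quotient under the ceiling is positive, which rules out index 0, where there is
   no iterate. *)
have k0 : (0 < k)%N.
  rewrite -(ltr_nat R); apply: lt_le_trans kK.
  rewrite divr_gt0// normr_gt0 lt_eqF// ln_lt0//.
  by rewrite subr_gt0 xi1 gtrBl.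
have [-> lb _] := prob _ t0 t1 ts k k0; split=> //.
apply: le_trans lb; rewrite lee_fin lerBrDr -lerBrDl.
by apply: onem_expr_le => //; apply: mulr_ile1 => //; exact: ltW.
Qed.
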